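(* Let $N\ge 2$, let $\Omega\subset\mathbb{R}^N$ be a bounded domain, and let $H:\Omega\times\mathbb{R}^N\to\mathbb{R}$ be continuous with $|H(x,\xi)|\le b|\xi|$ for all $(x,\xi)\in\Omega\times\mathbb{R}^N$, where $b\ge 0$ is a constant. If $\Omega\subset B_R$, then for any $1\le k<N$, $$bR<k\quad\Longrightarrow\quad \mu_k^+=\overline{\mu}_k^+=+\infty .$$ In particular, in the case $H\equiv 0$, for any bounded domain $\Omega$ one has $\mu_k^+=\overline{\mu}_k^+=+\infty$, and the operator $u\mapsto\mathcal{P}^-_k(D^2u)+\mu u$ satisfies the maximum principle in $\Omega$ for any $\mu\in\mathbb{R}$.
   Context: For a real symmetric $N\times N$ matrix $X$ with ordered eigenvalues $\lambda_1(X)\le\cdots\le\lambda_N(X)$, $\mathcal{P}^-_k(X)=\sum_{i=1}^k\lambda_i(X)$. $B_R$ is the open ball of radius $R>0$ centred at the origin. Viscosity sense: a real-valued $u$ is a subsolution, $F(x,u,\nabla u,D^2u)\ge 0$ (resp. supersolution, $F(x,u,\nabla u,D^2u)\le 0$) in $\Omega$ if it is upper (resp. lower) semicontinuous and, for every $x\in\Omega$ and every $C^2$ function $\varphi$ touching $u$ from above (resp. below) at $x$, $F(x,u(x),\nabla\varphi(x),D^2\varphi(x))\ge 0$ (resp. $\le 0$). Write $F[u]=F(x,u,\nabla u,D^2u)$. Maximum principle in $\Omega$: $F[u]\ge 0$ in $\Omega$ and $\limsup_{x\to\partial\Omega}u\le 0$ imply $u\le 0$ in $\Omega$. For the equation (E$_\mu$):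 $\mathcal{P}^-_k(D^2u)+H(x,\nabla u)+\mu u=0$ in $\Omega$, define $\overline{\mu}_k^+=\sup\{\mu\in\mathbb{R}:\ \exists\, w>0\text{ in }\overline\Omega\text{ a supersolution of (E}_\mu)\}$ (with $w$ real-valued and lower semicontinuous on $\overline\Omega$) and $\mu_k^+=\sup\{\mu\in\mathbb{R}:\ \exists\, w>0\text{ in }\Omega\text{ a supersolution of (E}_\mu)\}$. *)

(* Defs.v *)
From HB Require Import structures.
From mathcomp Require Import all_boot all_order all_algebra.
From mathcomp Require Import all_classical all_reals all_analysis.
From mathcomp Require spectral complex.

Set Implicit Arguments.
Unset Strict Implicit.
Unset Printing Implicit Defensive.

Import Order.TTheory GRing.Theory Num.Theory.
Import numFieldNormedType.Exports.

Local Open Scope classical_set_scope.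
Local Open Scope ring_scope.

(* The points of N-dimensional space are row vectors. The library's topology,
   boundedness and derivatives on ['rV[R]_N] come from the sup norm [`|x|],
   which is equivalent to the Euclidean norm; balls and |xi| are Euclidean. *)
Definition enorm (R : realType) (N : nat) (x : 'rV[R]_N) : R :=
  Num.sqrt (\sum_(i < N) x 0 i ^+ 2).

Definition eball (R : realType) (N : nat) (r : R) : set 'rV[R]_N :=
  [set x | enorm x < r].

Definition bounded_domain (R : realType) (N : nat) (Om : set 'rV[R]_N) : Prop :=
  [/\ open Om, connected Om, Om !=set0 & bounded_set Om].

(* Eigenvalues in nondecreasing order, repeated according to multiplicity; the
   (i+1)-st smallest one is [(ordered_eigenvalues X)`_i]. The default [::] is
   only returned when the characteristic polynomial does not split over R,
   which is impossible for symmetric X: see [ordered_eigenvaluesP]. *)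
Definition ordered_eigenvalues (R : realType) (N : nat) (X : 'M[R]_N) : seq R :=
  xget [::] [set s : seq R | sorted <=%R s /\
                             char_poly X = \prod_(a <- s) ('X - a%:P)].

Definition Pminus (R : realType) (N k : nat) (X : 'M[R]_N) : R :=
  \sum_(i < k) (ordered_eigenvalues X)`_i.

Section SymmetricSpectrum.
Import spectral complex.

Lemma sym_char_poly_split (R : realType) (N : nat) (X : 'M[R]_N) :
  X^T = X -> exists s : seq R, char_poly X = \prod_(a <- s) ('X - a%:P).
Proof.
move=> symX.
pose f : {rmorphism R -> R[i]} := real_complex R.
pose Y := map_mx f X.
have hY : Y \is hermsymmx.
  apply/is_hermitianmxP; rewrite expr0 scale1r; apply/matrixP => i j.
  rewrite !mxE -[in LHS]symX mxE.
  by rewrite conj_Creal//; apply/complex_realP; exists (X j i).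
have /orthomx_spectralP := hermitian_normalmx hY.
set P := spectralmx Y; set sp := spectral_diag Y => YE.
have spR : sp \is a realmx := hermitian_spectral_diag_real hY.
have Pu : P \in unitmx := spectral_unit Y.
have cY : char_poly Y = \prod_i ('X - (sp 0 i)%:P).
  have -> : char_poly Y = char_poly (diag_mx sp).
    rewrite /char_poly /char_poly_mx {1}YE !map_mxM.
    have PP : map_mx polyC (invmx P) *m map_mx polyC P = 1%:M.
      by rewrite -map_mxM mulVmx// map_mx1.
    have XE : 'X%:M = map_mx polyC (invmx P) *m 'X%:M *m map_mx polyC P.
      by rewrite mul_mx_scalar -scalemxAl PP scalemx1.
    by rewrite {1}XE -mulmxBl -mulmxBr !det_mulmx mulrAC -det_mulmx PP det1 mul1r.
  rewrite char_poly_trig ?diag_mx_is_trig//.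
  by apply: eq_bigr => i _; rewrite mxE eqxx mulr1n.
exists [seq complex.Re (sp 0 i) | i <- enum 'I_N].
apply: (map_poly_inj f).
rewrite map_char_poly -/Y cY rmorph_prod big_map big_enum.
apply: eq_bigr => i _; rewrite /= map_polyXsubC; congr ('X - _%:P).
have /mxOverP/(_ 0 i) := spR.
by case/complex_realP => r ->.
Qed.
End SymmetricSpectrum.

Lemma ordered_eigenvaluesP (R : realType) (N : nat) (X : 'M[R]_N) :
  X^T = X -> sorted <=%R (ordered_eigenvalues X) /\
    char_poly X = \prod_(a <- ordered_eigenvalues X) ('X - a%:P).
Proof.
move=> /sym_char_poly_split[s Xs].
pose S : set (seq R) := [set s | sorted <=%R s /\
  char_poly X = \prod_(a <- s) ('X - a%:P)].
apply: (@xgetPex _ [::] S); exists (sort <=%R s); split.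
  by apply: sort_sorted; exact: le_total.
by rewrite Xs; apply: perm_big; rewrite perm_sym; apply/permPl/perm_sort.
Qed.

Lemma ordered_eigenvalues_uniq (R : realType) (N : nat) (X : 'M[R]_N)
    (s : seq R) :
  sorted <=%R s -> char_poly X = \prod_(a <- s) ('X - a%:P) ->
  ordered_eigenvalues X = s.
Proof.
move=> s_sorted Xs; apply: xget_unique => // t [t_sorted Xt].
apply: (sorted_eq le_trans le_anti) => //.
by apply: prod_XsubC_eq; rewrite -Xt Xs.
Qed.

Section Calculus.
Variables (R : realType) (N : nat).
Implicit Types (f : 'rV[R]_N -> R) (U : set 'rV[R]_N).

Definition partial (i : 'I_N) f : 'rV[R]_N -> R :=
  fun x => 'D_(delta_mx 0 i) f x.

Definition grad f (x : 'rV[R]_N) : 'rV[R]_N := \row_i partial i f x.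

Definition hess f (x : 'rV[R]_N) : 'M[R]_N :=
  \matrix_(i, j) partial i (partial j f) x.

Definition has_partial (i : 'I_N) f (x : 'rV[R]_N) : Prop :=
  derivable f x (delta_mx 0 i).

(* f is C^2 on the open set U: all partial derivatives of order at most 2 exist
   and are continuous on U. *)
Definition C2_on U f : Prop := forall x, U x ->
  [/\ {for x, continuous f},
      forall i, has_partial i f x /\ {for x, continuous (partial i f)} &
      forall i j, has_partial i (partial j f) x /\
                  {for x, continuous (partial i (partial j f))}].

End Calculus.

Section Viscosity.
Variables (R : realType) (N : nat).
Implicit Types (Om D : set 'rV[R]_N) (u w : 'rV[R]_N -> R).

(* A real-valued function on a subset D is a total function whose values outside
   D are never used: semicontinuity is relative to D. *)
Definition lsc_on D u : Prop :=
  lower_semicontinuous ((fun x => (u x)%:E) : subspace D -> \bar R).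

Definition usc_on D u : Prop := lsc_on D (fun x => - u x).

(* phi, of class C^2 in the open neighbourhood U of x, touches u at x. *)
Definition touches_above Om u (x : 'rV[R]_N) (phi : 'rV[R]_N -> R) : Prop :=
  exists U : set 'rV[R]_N,
    [/\ open U, U x, U `<=` Om, C2_on U phi &
        phi x = u x /\ forall y, U y -> u y <= phi y].

Definition touches_below Om u (x : 'rV[R]_N) (phi : 'rV[R]_N -> R) : Prop :=
  exists U : set 'rV[R]_N,
    [/\ open U, U x, U `<=` Om, C2_on U phi &
        phi x = u x /\ forall y, U y -> phi y <= u y].

Definition operator := 'rV[R]_N -> R -> 'rV[R]_N -> 'M[R]_N -> R.

Definition subsolution (F : operator) Om u : Prop :=
  usc_on Om u /\
  forall x phi, Om x -> touches_above Om u x phi ->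
    0 <= F x (u x) (grad phi x) (hess phi x).

Definition supersolution (F : operator) Om u : Prop :=
  lsc_on Om u /\
  forall x phi, Om x -> touches_below Om u x phi ->
    F x (u x) (grad phi x) (hess phi x) <= 0.

Definition boundary Om : set 'rV[R]_N := closure Om `\` Om^°.

Definition maximum_principle (F : operator) Om : Prop :=
  forall u, subsolution F Om u ->
    (limf_esup (fun x => (u x)%:E) (within Om (set_nbhs (boundary Om)))
       <= 0)%E ->
    forall x, Om x -> u x <= 0.

(* The left-hand side of (E_mu). *)
Definition Eop (k : nat) (H : 'rV[R]_N -> 'rV[R]_N -> R) (mu : R) : operator :=
  fun x r xi X => Pminus k X + H x xi + mu * r.

Definition mu_bar (k : nat) (H : 'rV[R]_N -> 'rV[R]_N -> R) Om : \bar R :=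
  ereal_sup [set mu%:E | mu in [set mu : R | exists w,
    [/\ forall x, closure Om x -> 0 < w x, lsc_on (closure Om) w &
        supersolution (Eop k H mu) Om w]]].

Definition mu_plus (k : nat) (H : 'rV[R]_N -> 'rV[R]_N -> R) Om : \bar R :=
  ereal_sup [set mu%:E | mu in [set mu : R | exists w,
    (forall x, Om x -> 0 < w x) /\ supersolution (Eop k H mu) Om w]].

End Viscosity.

(* Main.v *)
Require Import Defs.
From mathcomp Require Import all_boot all_order all_algebra.
From mathcomp Require Import all_classical all_reals all_analysis.
From mathcomp Require spectral complex.
From mathcomp Require Import ring lra.

(** The proof rests on the Gaussian [w x = expR (- a * |x|^2)]. On the
    hyperplane orthogonal to [x] its Hessian is [- 2 a w] times the identity,
    and this hyperplane has dimension [N - 1 >= k], so [Pminus k (hess w)] is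
    at most [- 2 a k w]: it is the one direction in which [w] is not concave
    that the condition [k < N] throws away. The gradient is [- 2 a w x], hence
    the first order term is at most [2 a w b r] when [Om] lies in the ball of
    radius [r], and
      [Pminus k (hess w) + H x (grad w) + mu w <= w (mu - 2 a (k - b r))].
    When [b r < k], taking [a] large makes this negative for any given [mu].
    Since [w] is positive everywhere, both suprema are infinite.

    For a test function [phi] touching [w] from below only the values of
    [hess phi] on the hyperplane matter, and there [hess phi <= hess w] by the
    one-variable second derivative test along lines
    ([touching_derivatives]). What makes this enough is one half of the
    Courant-Fischer principle ([eigenvalue_le_of_hyperplane]): a bound on the
    quadratic form of a symmetric matrix on a hyperplane bounds all its
    eigenvalues but the largest. Symmetry of [hess phi] is Schwarz's theorem
    ([hess_sym]).

    For the maximum principle, let [u] be a subsolution with nonpositive upper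
    limit at the boundary that is positive somewhere. Then [u / w] attains a
    positive maximum [t] over [Om] ([usc_attains_max]): as [w] is bounded
    below on the compact closure of [Om], near the boundary [u] is smaller
    than any given positive multiple of [w]. So [t w]
    touches [u] from above, and the strict inequality above, which is
    homogeneous, contradicts that [u] is a subsolution. *)

Import Order.TTheory GRing.Theory Num.Theory.
Import numFieldNormedType.Exports.

Set Implicit Arguments.
Unset Strict Implicit.
Unset Printing Implicit Defensive.

Local Open Scope classical_set_scope.
Local Open Scope ring_scope.

(** * Eigenvalues of a symmetric matrix that is bounded on a hyperplane *)

Section Spectrum.

Import spectral complex.
Local Open Scope sesquilinear_scope.

Lemma count_ge_nth_sorted (R : realType) (s : seq R) (m : nat) :
  sorted <=%R s -> (m <= size s)%N ->
  (size s - m <= count (fun a => (s`_m <= a)%R) s)%N.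
Proof.
move=> s_sorted ms.
rewrite -[X in (_ <= count _ X)%N](cat_take_drop m) count_cat.
apply: leq_trans (leq_addl _ _).
suff /eqP <- : count (fun a => (s`_m <= a)%R) (drop m s) == (size s - m)%N.
  by [].
rewrite -size_drop -all_count; apply/(all_nthP 0) => j.
rewrite size_drop ltn_subRL => js; rewrite nth_drop.
apply: (sorted_leq_nth le_trans le_refl) => //; rewrite ?inE ?leq_addr//.
exact: leq_ltn_trans (leq_addr _ _) js.
Qed.

Lemma orthogonal_combination (C : fieldType) (a b : C) :
  exists u v : C, ((u != 0) || (v != 0)) /\ u * a + v * b = 0.
Proof.
have [a0|a0] := eqVneq a 0.
  by exists 1, 0; rewrite a0 oner_neq0 mulr0 mul0r addr0.
by exists b, (- a); rewrite oppr_eq0 a0 orbT mulNr mulrC subrr.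
Qed.

(** If the eigenvalue of index [i] exceeded [c], at least two eigenvectors would
    have eigenvalues above [c]; a nonzero combination of these is orthogonal
    to [x], and the quadratic form is too large on it. The eigenvectors come
    from the complex spectral theorem, so the combination is complex; as [x] is
    real, its real and imaginary parts are both orthogonal to [x], and the
    Hermitian form is the sum of the two values of the real form. *)
Lemma eigenvalue_le_of_hyperplane (R : realType) (N : nat) (X : 'M[R]_N)
    (x : 'rV[R]_N) (c : R) :
  X^T = X ->
  (forall v : 'rV[R]_N, (v *m x^T) 0 0 = 0 ->
    (v *m X *m v^T) 0 0 <= c * (v *m v^T) 0 0) ->
  forall i, (i.+1 < N)%N -> (ordered_eigenvalues X)`_i <= c.
Proof.
move=> symX Xc i iN.
have [s_sorted sX] := ordered_eigenvaluesP symX.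
set s := ordered_eigenvalues X in s_sorted sX *.
have sN : size s = N.
  by move: (size_char_poly X); rewrite sX size_prod_XsubC => -[].
pose f : {rmorphism R -> R[i]} := real_complex R.
pose Y := map_mx f X.
have hY : Y \is hermsymmx.
  apply/is_hermitianmxP; rewrite expr0 scale1r; apply/matrixP => k l.
  rewrite !mxE -[in LHS]symX mxE.
  by rewrite conj_Creal//; apply/complex_realP; exists (X l k).
have /orthomx_spectralP := hermitian_normalmx hY.
set P := spectralmx Y; set sp := spectral_diag Y => YE.
have Pu : P \is unitarymx := spectral_unitarymx Y.
have PP : P *m P^t* = 1%:M by exact/unitarymxP.
have cY : char_poly Y = \prod_l ('X - (sp 0 l)%:P).
  have -> : char_poly Y = char_poly (diag_mx sp).
    rewrite /char_poly /char_poly_mx {1}YE !map_mxM.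
    have QQ : map_mx polyC (invmx P) *m map_mx polyC P = 1%:M.
      by rewrite -map_mxM mulVmx ?map_mx1// unitarymx_unit.
    have XE : 'X%:M = map_mx polyC (invmx P) *m 'X%:M *m map_mx polyC P.
      by rewrite mul_mx_scalar -scalemxAl QQ scalemx1.
    rewrite {1}XE -mulmxBl -mulmxBr !det_mulmx mulrAC -det_mulmx QQ det1.
    by rewrite mul1r.
  rewrite char_poly_trig ?diag_mx_is_trig//.
  by apply: eq_bigr => l _; rewrite mxE eqxx mulr1n.
have sp_perm : perm_eq (map f s) [seq sp 0 l | l <- enum 'I_N].
  apply: prod_XsubC_eq; rewrite big_map [RHS]big_map big_enum/= -cY.
  rewrite -map_char_poly sX rmorph_prod.
  by apply: eq_bigr => a _; rewrite /= map_polyXsubC.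
pose A := [set l | f s`_i <= sp 0 l]%SET.
(* [i.+1 < N] leaves at least two places in the sorted sequence from [i] on. *)
have : (1 < #|A|)%N.
  have -> : #|A| = count (fun z => f s`_i <= z) [seq sp 0 l | l <- enum 'I_N].
    rewrite count_map cardsE cardE {1}/enum_mem size_filter -enumT.
    by apply: eq_count => l; rewrite !inE.
  rewrite -(permP sp_perm) count_map.
  rewrite (_ : count _ s = count (fun a => s`_i <= a) s); last first.
    by apply: eq_count => a /=; rewrite lecR.
  apply: leq_trans (count_ge_nth_sorted s_sorted _); rewrite sN.
    by rewrite ltn_subRL addn1.
  by rewrite ltnW // ltnW.
case/card_gt1P => k [l [kA lA kl]].
pose xc := map_mx f x.
have [u [v [uv0 uv]]] := orthogonal_combination
  ((row k P *m xc^T) 0 0) ((row l P *m xc^T) 0 0).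
(* [z] has coordinates [cc] in the orthonormal basis of the rows of [P]. *)
pose cc : 'rV[R[i]]_N := u *: delta_mx 0 k + v *: delta_mx 0 l.
pose z := cc *m P.
have cck : cc 0 k = u by rewrite !mxE !eqxx (negPf kl) mulr1 mulr0 addr0.
have ccl : cc 0 l = v.
  by rewrite !mxE !eqxx eq_sym (negPf kl) mulr1 mulr0 add0r.
have cc0 j : cc 0 j != 0 -> j \in A.
  rewrite !mxE eqxx /=; have [->//|_] := eqVneq j k.
  have [->//|_] := eqVneq j l.
  by rewrite !mulr0 addr0 eqxx.
have zx : (z *m xc^T) 0 0 = 0.
  rewrite /z /cc !mulmxDl -!scalemxAl -!rowE -[RHS]uv mxE.
  by congr (_ + _); rewrite mxE.
have zz : (z *m z^t*) 0 0 = \sum_j `|cc 0 j| ^+ 2.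
  rewrite /z trmx_mul map_mxM -mulmxA (mulmxA P) PP mul1mx mxE.
  by apply: eq_bigr => j _; rewrite !mxE normCK.
have zYz : (z *m Y *m z^t*) 0 0 = \sum_j sp 0 j * `|cc 0 j| ^+ 2.
  rewrite YE (invmx_unitary Pu) /z trmx_mul map_mxM.
  rewrite -!mulmxA (mulmxA P (P^t*)) PP mul1mx.
  rewrite (mulmxA P (P^t*)) PP mul1mx mulmxA mul_mx_diag mxE.
  apply: eq_bigr => j _; rewrite mxE [in X in _ * X]mxE [in X in _ * X]mxE.
  by rewrite normCK mulrAC mulrC.
have zY_ge : f s`_i * (z *m z^t*) 0 0 <= (z *m Y *m z^t*) 0 0.
  rewrite zz zYz mulr_sumr; apply: ler_sum => j _.
  have [->|/cc0] := eqVneq (cc 0 j) 0; first by rewrite normr0 expr0n !mulr0.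
  by rewrite inE => jA; rewrite ler_wpM2r// exprn_ge0.
have zz_gt0 : 0 < (z *m z^t*) 0 0.
  rewrite zz; apply: (@lt_le_trans _ _ (`|cc 0 k| ^+ 2 + `|cc 0 l| ^+ 2)).
    rewrite cck ccl; case/orP: uv0 => [u0|v0].
      by rewrite ltr_pwDl ?exprn_gt0 ?normr_gt0 ?exprn_ge0.
    by rewrite ltr_wpDl ?exprn_gt0 ?normr_gt0 ?exprn_ge0.
  rewrite (bigD1 k) //= lerD2l (bigD1 l) 1?eq_sym //= lerDl.
  by apply: sumr_ge0 => j _; rewrite exprn_ge0.
clearbody z.
pose p := map_mx (@complex.Re R) z; pose q := map_mx (@complex.Im R) z.
have ReY (B : 'M[R]_N) : complex.Re ((z *m map_mx f B *m z^t*) 0 0) =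
    (p *m B *m p^T) 0 0 + (q *m B *m q^T) 0 0.
  rewrite !mxE raddf_sum -big_split; apply: eq_bigr => j _ /=.
  rewrite !mxE !mulr_suml raddf_sum -big_split; apply: eq_bigr => m _ /=.
  rewrite !mxE; case: (z 0 m) (z 0 j) => [a a'] [b b'] /=.
  by rewrite !mulr0 subr0 add0r mulrN opprK.
have Rezz : complex.Re ((z *m z^t*) 0 0) =
    (p *m p^T) 0 0 + (q *m q^T) 0 0.
  by move: (ReY 1%:M); rewrite map_mx1 !mulmx1.
have px : (p *m x^T) 0 0 = 0.
  transitivity (complex.Re ((z *m xc^T) 0 0)); last by rewrite zx.
  rewrite !mxE raddf_sum; apply: eq_bigr => j _; rewrite !mxE.
  by case: (z 0 j) => a b /=; rewrite mulr0 subr0.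
have qx : (q *m x^T) 0 0 = 0.
  transitivity (complex.Im ((z *m xc^T) 0 0)); last by rewrite zx.
  rewrite !mxE raddf_sum; apply: eq_bigr => j _; rewrite !mxE.
  by case: (z 0 j) => a b /=; rewrite mulr0 add0r.
have sz : s`_i * complex.Re ((z *m z^t*) 0 0) <=
          complex.Re ((z *m Y *m z^t*) 0 0).
  move: zY_ge; rewrite lecE => /andP[_].
  by case: ((z *m z^t*) 0 0) => a b /=; rewrite mul0r subr0.
have zz0 : 0 < complex.Re ((z *m z^t*) 0 0).
  by move: zz_gt0; rewrite ltcE => /andP[].
have := le_trans sz (_ : _ <= c * complex.Re ((z *m z^t*) 0 0)).
rewrite ler_pM2r//; apply.
by rewrite ReY Rezz mulrDr lerD ?Xc.
Qed.
End Spectrum.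

Lemma Pminus_le_hyperplane (R : realType) (N k : nat) (X : 'M[R]_N)
    (x : 'rV[R]_N) (c : R) :
  (k < N)%N -> X^T = X ->
  (forall v : 'rV[R]_N, (v *m x^T) 0 0 = 0 ->
    (v *m X *m v^T) 0 0 <= c * (v *m v^T) 0 0) ->
  Pminus k X <= k%:R * c.
Proof.
move=> kN symX Xc.
rewrite mulr_natl -[in leRHS](card_ord k) -sumr_const; apply: ler_sum => i _.
by apply: (eigenvalue_le_of_hyperplane symX Xc); apply: leq_ltn_trans kN.
Qed.

(** * Directional derivatives of functions with continuous partials *)

Section Directional.
Variables (R : realType) (N : nat).
Implicit Types (f : 'rV[R]_N -> R) (x v : 'rV[R]_N).

Lemma is_derive_line f x v (t d : R) :
  is_derive (x + t *: v) v f d -> is_derive t 1 (fun s => f (x + s *: v)) d.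
Proof.
have E : (fun h : R => h^-1 *: (((fun s => f (x + s *: v)) \o shift t) (h *: 1)
      - f (x + t *: v))) =
    (fun h : R => h^-1 *: ((f \o shift (x + t *: v)) (h *: v)
      - f (x + t *: v))).
  apply/funext => h /=; rewrite /shift /=; congr (_ *: (f _ - _)).
  by rewrite [h%:A]mulr1 scalerDl addrCA.
move=> [fd <-]; apply: DeriveDef.
  by rewrite /derivable E.
by rewrite /derive E.
Qed.

Lemma is_derive_line0 f x v (d : R) :
  is_derive (0 : R) 1 (fun s => f (x + s *: v)) d -> is_derive x v f d.
Proof.
have E : (fun h : R => h^-1 *: (((fun s => f (x + s *: v)) \o shift 0) (h *: 1)
      - f (x + 0 *: v))) =
    (fun h : R => h^-1 *: ((f \o shift x) (h *: v) - f x)).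
  apply/funext => h /=; rewrite /shift /= scale0r !addr0.
  by rewrite [h%:A]mulr1 [x + _]addrC.
case=> fd fE; have fd2 : derivable f x v by move: fd; rewrite /derivable E.
by apply: (DeriveDef fd2); rewrite -fE /derive E.
Qed.

(** The mean value inequality for [s |-> g s - s * d], for [t] of either
    sign. *)
Lemma increment_bound (g dg : R -> R) (t d e : R) :
  (forall s : R, `|s| <= `|t| -> is_derive s 1 g (dg s) /\ `|dg s - d| <= e) ->
  `|g t - g 0 - t * d| <= e * `|t|.
Proof.
move=> gt.
have gc (s : R) : `|s| <= `|t| -> {for s, continuous g}.
  move=> /gt[[gs _] _].
  exact/differentiable_continuous/derivable1_diffP.
have main s : `|s| <= `|t| -> g t - g 0 = dg s * t ->
    `|g t - g 0 - t * d| <= e * `|t|.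
  move=> /gt[_ ds] ->.
  by rewrite mulrC -mulrBr normrM mulrC ler_wpM2r.
have [t0|t0] := leP 0 t.
  have nt s : s \in `[0, t] -> `|s| <= `|t|.
    by rewrite in_itv/= => /andP[s0 st]; rewrite !ger0_norm// (le_trans s0).
  have [s||s st] := @MVT_segment _ g dg 0 t t0.
  - by move=> /subset_itv_oo_cc/nt/gt[].
  - apply: continuous_in_subspaceT => s; rewrite inE => /nt; exact: gc.
  by rewrite subr0; apply: main; apply: nt.
have nt s : s \in `[t, 0] -> `|s| <= `|t|.
  rewrite in_itv/= => /andP[st s0]; rewrite !ler0_norm ?lerN2//.
  exact: ltW.
have [s||s st E] := @MVT_segment _ g dg t 0 (ltW t0).
- by move=> /subset_itv_oo_cc/nt/gt[].
- apply: continuous_in_subspaceT => s; rewrite inE => /nt; exact: gc.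
by apply: (main s); [exact: nt|rewrite -opprB E sub0r mulrN opprK].
Qed.

(** Strict differentiability in the direction [v]: the base point of the
    difference quotient may move too. Unlike the existence of directional
    derivatives it is additive in [v], so that it passes from the coordinate
    directions to all others without telescoping over coordinates. *)
Definition strict_derive f x v (d : R) := forall e : R, 0 < e ->
  \forall y \near x & h \near (0 : R),
    `|f (y + h *: v) - f y - h * d| <= e * `|h|.

Lemma strict_derive_is_derive f x v d :
  strict_derive f x v d -> is_derive x v f d.
Proof.
move=> fd.
have fc : (fun h : R => h^-1 *: ((f \o shift x) (h *: v) - f x)) @ 0^' --> d.
  apply/cvgrPdist_le => e e0.
  have [[A B] /= [Ax B0] AB] := fd e e0.
  rewrite near_withinE /=; apply: (@filterS _ _ _ B) => // h Bh h0.
  have := AB (x, h) (conj (nbhs_singleton Ax) Bh); rewrite /= => xh.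
  rewrite distrC [h *: v + x]addrC.
  rewrite -(ler_pM2r (_ : 0 < `|h|)) ?normr_gt0// -normrM.
  rewrite (_ : _ * h = f (x + h *: v) - f x - h * d)//.
  by rewrite mulrBl [d * h]mulrC [_ *: _]mulrC mulfVK.
apply: DeriveDef; first by apply/cvg_ex; exists d.
exact: cvg_lim fc.
Qed.

Lemma strict_derive0 f x : strict_derive f x 0 0.
Proof.
move=> e e0; near=> y h.
by rewrite scaler0 addr0 mulr0 subrr subr0 normr0 mulr_ge0// ltW.
Unshelve. all: by end_near. Qed.

Lemma shift_cvg x v :
  (z.1 + z.2 *: v) @[z --> filter_prod (nbhs x) (nbhs (0 : R))] --> x.
Proof.
pose F := filter_prod (nbhs x) (nbhs (0 : R)).
have FF : Filter F by exact: filter_prod_filter.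
have sv : (z.2 *: v) @[z --> F] --> (0 : R) *: v.
  by apply: (@cvgZr_tmp _ _ _ F FF snd 0 v); exact: cvg_snd.
have fx : z.1 @[z --> F] --> x by exact: cvg_fst.
have := cvgD fx sv.
by rewrite scale0r addr0; apply.
Qed.

(** The increment along [v + w] is the one along [v] followed by the one along
    [w] from a moved base point. *)
Lemma strict_deriveD f x v w c d :
  strict_derive f x v c -> strict_derive f x w d ->
  strict_derive f x (v + w) (c + d).
Proof.
move=> fv fw e e0; have e20 : 0 < e / 2 by rewrite divr_gt0.
have fv2 := fv _ e20.
have shift_cvg := @shift_cvg x v.
pose F := filter_prod (nbhs x) (nbhs (0 : R)).
have FF : Filter F by exact: filter_prod_filter.
have cvw : (z.1 + z.2 *: v, z.2) @[z --> F] --> F.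
  apply: (@cvg_pair _ _ _ F (nbhs x) (nbhs 0) _ _ _ _ snd shift_cvg).
  exact: cvg_snd.
have fw2 := cvw _ (fw _ e20).
near=> z.
have fvz : `|f (z.1 + z.2 *: v) - f z.1 - z.2 * c| <= e / 2 * `|z.2|.
  by near: z.
have fwz : `|f (z.1 + z.2 *: v + z.2 *: w) - f (z.1 + z.2 *: v) - z.2 * d|
    <= e / 2 * `|z.2| by near: z.
rewrite scalerDr addrA.
rewrite (_ : _ - _ = (f (z.1 + z.2 *: v) - f z.1 - z.2 * c) +
  (f (z.1 + z.2 *: v + z.2 *: w) - f (z.1 + z.2 *: v) - z.2 * d)); last by ring.
rewrite (splitr e) mulrDl; apply: le_trans (ler_normD _ _) _; exact: lerD.
Unshelve. all: by end_near. Qed.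


(** Keeps the whole segment used by the mean value theorem inside a
    neighbourhood of [x], uniformly in the base point [y]. *)
Lemma line_near (P : set 'rV[R]_N) x v : nbhs x P ->
  \forall y \near x & d \near (0 : R),
    forall s, `|s| <= `|d| -> P (y + s *: v).
Proof.
move=> Px.
have := @shift_cvg x v P Px; case=> -[A B] /= [Ax /nbhs_ballP[r /= r0 rB]] AB.
exists (A, [set d | `|d| < r]) => /=.
  split=> //; apply/nbhs_ballP; exists r => //= d.
  by rewrite /ball/= sub0r normrN.
move=> [y d] /= [Ay dr] s sd; apply: (AB (y, s)); split => //=.
by apply: rB; rewrite /ball/= sub0r normrN (le_lt_trans sd).
Qed.

Lemma strict_derive_partial f x (i : 'I_N) (c : R) :
  (\forall y \near x, has_partial i f y) ->
  {for x, continuous (partial i f)} ->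
  strict_derive f x (c *: delta_mx 0 i) (c * partial i f x).
Proof.
move=> fi fic e e0.
(* The step along the coordinate axis is [h * c]; the [+ 1] allows [c = 0]. *)
pose e' := e / (`|c| + 1).
have c1 : 0 < `|c| + 1 by rewrite ltr_wpDl.
have e'0 : 0 < e' by rewrite divr_gt0.
have /cvgrPdistC_le/(_ _ e'0) fie := fic.
have : nbhs x [set y | has_partial i f y /\
    `|partial i f y - partial i f x| <= e'].
  by apply: filterI.
move=> /(line_near (delta_mx 0 i))[[A B] /= [Ax]].
move=> B0 AB.
have Bc : nbhs (0 : R) [set h | B (h * c)].
  have := @mulrr_continuous R c 0; rewrite /continuous_at mul0r; apply.
  exact: B0.
exists (A, [set h | B (h * c)]) => // -[y h] /= [Ay Bh].
have {}AB := AB (y, h * c) (conj Ay Bh).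
have := @increment_bound (fun s => f (y + s *: delta_mx 0 i))
  (fun s => partial i f (y + s *: delta_mx 0 i)) (h * c) (partial i f x) e'.
rewrite scale0r addr0 scalerA mulrA => H; apply: le_trans (H _) _.
  move=> s sh; have [fs ds] := AB s sh.
  split=> //; apply: is_derive_line; exact: derivableP.
rewrite normrM mulrCA [e * _]mulrC ler_wpM2l// /e' mulrAC ler_pdivrMr//.
by rewrite ler_wpM2l ?lerDl// ltW.
Qed.

Lemma strict_derive_grad f x v :
  (forall i, \forall y \near x, has_partial i f y) ->
  (forall i, {for x, continuous (partial i f)}) ->
  strict_derive f x v (\sum_i v 0 i * partial i f x).
Proof.
move=> fi fic; rewrite {1}(row_sum_delta v).
elim/big_ind2 : _ => [|w c w' c' wc wc'|i _].
- exact: strict_derive0.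
- exact: strict_deriveD.
- exact: strict_derive_partial.
Qed.

(** The second difference over a parallelogram with sides along [v] and the
    [i]-th axis is [h^2] times the second derivative up to [o(h^2)]: apply the
    mean value inequality along the axis to the difference of [f] on the two
    parallel sides, whose derivative is controlled by the strict derivative of
    [partial i f]. *)
Lemma mixed_increment f x v (i : 'I_N) (d : R) :
  (\forall y \near x, has_partial i f y) ->
  strict_derive (partial i f) x v d ->
  forall e, 0 < e -> \forall h \near (0 : R),
    `|f (x + h *: v + h *: delta_mx 0 i) - f (x + h *: delta_mx 0 i)
      - (f (x + h *: v) - f x) - h * (h * d)| <= e * `|h| * `|h|.
Proof.
move=> fi fid e e0.
have [[A B] /= [Ax B0] AB] := fid e e0.
have [[A' B'] /= [Ax' B0'] AB'] :=
  line_near (delta_mx 0 i) (filterI fi Ax).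
have xv : nbhs (0 : R) [set h | A' (x + h *: v)].
  have [[A2 B2] /= [Ax2 B02] AB2] := @shift_cvg x v A' Ax'.
  apply: filterS B02 => h Bh; apply: (AB2 (x, h)); split=> //.
  exact: nbhs_singleton.
near=> h.
have Ahv : A' (x + h *: v) by near: h.
have Bh : B h by near: h.
have Bh' : B' h by near: h.
pose g s := f (x + h *: v + s *: delta_mx 0 i) - f (x + s *: delta_mx 0 i).
have := @increment_bound g
  (fun s => partial i f (x + h *: v + s *: delta_mx 0 i)
            - partial i f (x + s *: delta_mx 0 i)) h (h * d) (e * `|h|).
rewrite /g scale0r !addr0; apply=> s sh.
have [f1 _] := AB' (_, h) (conj Ahv Bh') s sh.
have [f2 As] := AB' (x, h) (conj (nbhs_singleton Ax') Bh') s sh.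
split.
  by apply: is_deriveB; apply: is_derive_line; exact: derivableP.
rewrite (addrAC x (h *: v) (s *: delta_mx 0 i)).
exact: (AB (x + s *: delta_mx 0 i, h) (conj As Bh)).
Unshelve. all: by end_near. Qed.

End Directional.

(** * Second order conditions at a touching point *)

Section SecondOrder.
Variables (R : realType) (N : nat) (U : set 'rV[R]_N).
Implicit Types (f : 'rV[R]_N -> R) (x v : 'rV[R]_N).

Lemma C2_strict_derive f x v : open U -> C2_on U f -> U x ->
  strict_derive f x v (\sum_i v 0 i * partial i f x).
Proof.
move=> oU fU Ux; apply: strict_derive_grad => i.
  by apply: filterS (open_nbhs_nbhs (conj oU Ux)) => y /fU[_ /(_ i)[]].
by have [_ /(_ i)[]] := fU x Ux.
Qed.

Lemma C2_strict_derive_partial f x v j : open U -> C2_on U f -> U x ->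
  strict_derive (partial j f) x v (\sum_i v 0 i * partial i (partial j f) x).
Proof.
move=> oU fU Ux; apply: strict_derive_grad => i.
  by apply: filterS (open_nbhs_nbhs (conj oU Ux)) => y /fU[_ _ /(_ i j)[]].
by have [_ _ /(_ i j)[]] := fU x Ux.
Qed.

(** Schwarz's theorem: the second difference over a coordinate square does not
    depend on the order of the two axes, and divided by [h^2] it tends to each
    of the two mixed derivatives. *)
Lemma hess_sym f x : open U -> C2_on U f -> U x -> (hess f x)^T = hess f x.
Proof.
move=> oU fU Ux; apply/matrixP => j i; rewrite !mxE.
have mixed k l e : 0 < e -> \forall h \near (0 : R),
    `|f (x + h *: delta_mx 0 l + h *: delta_mx 0 k)
      - f (x + h *: delta_mx 0 k) - (f (x + h *: delta_mx 0 l) - f x)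
      - h * (h * partial l (partial k f) x)| <= e * `|h| * `|h|.
  apply: mixed_increment.
    by apply: filterS (open_nbhs_nbhs (conj oU Ux)) => y /fU[_ /(_ k)[]].
  have := C2_strict_derive_partial (delta_mx 0 l) k oU fU Ux.
  rewrite (bigD1 l)//= big1 ?addr0 => [|m ml].
    by rewrite mxE !eqxx mul1r.
  by rewrite mxE (negPf ml) andbF mul0r.
set a := partial i _ x; set b := partial j _ x.
apply/eqP; rewrite -subr_eq0 -normr_le0; apply/ler_addgt0Pr => e e0.
rewrite add0r; have e20 : 0 < e / 2 by rewrite divr_gt0.
have Ma := mixed j i _ e20; have Mb := mixed i j _ e20.
have [h [[ha hb] h0]] := filter_ex
  (filterI (nbhs_dnbhs (filterI Ma Mb)) (nbhs_dnbhs_neq (0 : R))).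
rewrite /= -/a -/b in ha hb.
have hh : 0 < `|h| * `|h| by rewrite mulr_gt0 ?normr_gt0.
rewrite -(ler_pM2r hh) -!normrM.
rewrite (addrAC x (h *: delta_mx 0 j) (h *: delta_mx 0 i)) in hb.
have := le_trans (ler_normB _ _) (lerD hb ha).
rewrite (_ : _ - _ = (a - b) * (h * h)); last by ring.
by rewrite -!(mulrA (e / 2)) -mulrDl -splitr -!normrM.
Qed.

End SecondOrder.

(** If [F2 > 0] then [F1 > 0] just to the right of [0], and the mean value
    theorem makes [F] exceed [F 0] there. *)
Lemma second_order_max (R : realType) (F F1 : R -> R) (F2 : R) :
  (\forall t \near (0 : R), F t <= F 0) ->
  (\forall t \near (0 : R), is_derive (t : R) 1 F (F1 t)) ->
  is_derive (0 : R) 1 F1 F2 -> F1 0 = 0 /\ F2 <= 0.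
Proof.
move=> Fmax FF1 F1F2.
have : nbhs (0 : R) [set t | F t <= F 0 /\ is_derive (t : R) 1 F (F1 t)].
  exact: filterI.
move=> /nbhs_ballP[r /= r0 rF].
have {}rF (t : R) : `|t| < r -> F t <= F 0 /\ is_derive t 1 F (F1 t).
  by move=> tr; apply: rF; rewrite /ball/= sub0r normrN.
have rr t : t \in `]- r, r[ -> `|t| < r by rewrite in_itv/= ltr_norml.
have F10 : F1 0 = 0.
  have [|t /rr/rF[_ []]//||t /rr/rF[]//|_ D0] :=
    @derive1_at_max _ F (- r) r 0.
  - by rewrite ge0_cp// ltW.
  - by rewrite in_itv/= oppr_lt0 r0.
  by have [|_ [_ <-]] := rF 0; rewrite ?normr0 ?D0.
split=> //; rewrite leNgt; apply/negP => F20.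
have : h^-1 *: (F1 h - F1 0) @[h --> (0 : R)^'] --> F2.
  case: F1F2 => + <-; rewrite /derivable /derive.
  rewrite (_ : (fun h => _) = (fun h => h^-1 *: (F1 h - F1 0)))//.
  by apply/funext => h /=; rewrite /shift/= addr0 [h%:A]mulr1.
move=> /cvgrPdist_lt/(_ _ F20); rewrite near_withinE => /nbhs_ballP[q /= q0 qF].
pose t := Num.min r q / 2.
have m0 : 0 < Num.min r q by rewrite lt_min r0.
have t0 : 0 < t by rewrite divr_gt0.
have tm : t < Num.min r q by rewrite /t; lra.
have tr : t < r by rewrite (lt_le_trans tm)// ge_min lexx.
have tq : t < q by rewrite (lt_le_trans tm)// ge_min lexx orbT.
have ts s : s \in `[0, t] -> `|s| < r.
  by rewrite in_itv/= => /andP[s0 st]; rewrite ger0_norm// (le_lt_trans st).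
have [||s st E] := @MVT _ F F1 0 t t0.
- by move=> s /subset_itv_oo_cc/ts/rF[].
- apply: continuous_in_subspaceT => s; rewrite inE => /ts/rF[_ [Fs _]].
  exact/differentiable_continuous/derivable1_diffP.
have Ft : F t <= F 0 by have [] := rF t; rewrite ?gtr0_norm.
move: st; rewrite in_itv/= => /andP[s0 st].
have := qF s; rewrite /ball/= sub0r normrN gtr0_norm// => /(_ (lt_trans st tq)).
move=> /(_ (lt0r_neq0 s0)); rewrite F10 subr0 => sF.
have F1s : 0 < F1 s.
  have : 0 < s^-1 * F1 s.
    by move: sF; rewrite ltr_norml => /andP[_]; rewrite /GRing.scale/=; lra.
  by rewrite pmulr_rgt0// invr_gt0.
move: E Ft; rewrite subr0 => /eqP; rewrite subr_eq => /eqP ->.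
by rewrite gerDr leNgt mulr_gt0.
Qed.

(** Both conclusions come from the maximum at [0] of the one-variable functions
    [t |-> phi (x + t v) - psi (x + t v)]; coordinate directions [v] give the
    gradient. *)
Lemma touching_derivatives (R : realType) (N : nat) (U : set 'rV[R]_N)
    (phi psi : 'rV[R]_N -> R) (x : 'rV[R]_N) :
  open U -> U x -> C2_on U phi -> C2_on U psi ->
  phi x = psi x -> (forall y, U y -> phi y <= psi y) ->
  grad phi x = grad psi x /\
  forall v : 'rV[R]_N,
    (v *m hess phi x *m v^T) 0 0 <= (v *m hess psi x *m v^T) 0 0.
Proof.
move=> oU Ux phiU psiU xE le_phi.
have key (v : 'rV[R]_N) :
    \sum_i v 0 i * partial i phi x - \sum_i v 0 i * partial i psi x = 0 /\
    (v *m hess phi x *m v^T) 0 0 - (v *m hess psi x *m v^T) 0 0 <= 0.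
  pose D f (y : 'rV[R]_N) : R := \sum_i v 0 i * partial i f y.
  have Uv : \forall t \near (0 : R), U (x + t *: v).
    have [[A B] /= [Ax B0] AB] :=
      @shift_cvg _ _ x v U (open_nbhs_nbhs (conj oU Ux)).
    apply: filterS B0 => t Bt; apply: (AB (x, t)); split=> //.
    exact: nbhs_singleton.
  have first f (t : R) : C2_on U f -> U (x + t *: v) ->
      is_derive t 1 (fun s => f (x + s *: v)) (D f (x + t *: v)).
    move=> fU Ut; apply: is_derive_line; apply: strict_derive_is_derive.
    exact: (C2_strict_derive (U := U)).
  have second f : C2_on U f ->
      is_derive (0 : R) 1 (fun s => D f (x + s *: v))
        ((v *m hess f x *m v^T) 0 0).
    move=> fU; apply: is_derive_line; rewrite scale0r addr0.
    have -> : (v *m hess f x *m v^T) 0 0 =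
        \sum_i v 0 i *: \sum_j v 0 j * partial j (partial i f) x.
      rewrite mxE; apply: eq_bigr => i _; rewrite !mxE mulrC; congr (_ * _).
      by apply: eq_bigr => j _; rewrite mxE.
    rewrite (_ : D f = \sum_i (v 0 i *: partial i f)); last first.
      by apply/funext => y; rewrite fct_sumE.
    apply: is_derive_sum => i; apply: is_deriveZ.
    apply: strict_derive_is_derive.
    exact: (C2_strict_derive_partial (U := U)).
  have := @second_order_max R (fun t => phi (x + t *: v) - psi (x + t *: v))
    (fun t => D phi (x + t *: v) - D psi (x + t *: v))
    ((v *m hess phi x *m v^T) 0 0 - (v *m hess psi x *m v^T) 0 0).
  rewrite scale0r addr0; apply.
  - by apply: filterS Uv => t Ut; rewrite xE subrr subr_le0 le_phi.
  - by apply: filterS Uv => t Ut; apply: is_deriveB; exact: first.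
  - by apply: is_deriveB; exact: second.
split=> [|v]; last by have [_] := key v; rewrite subr_le0.
apply/rowP => i; rewrite !mxE.
have delta f :
    \sum_j (delta_mx 0 i : 'rV[R]_N) 0 j * partial j f x = partial i f x.
  rewrite (bigD1 i)//= big1 ?addr0 => [|j ji]; rewrite mxE ?eqxx ?mul1r//.
  by rewrite (negPf ji) andbF mul0r.
by have [/eqP + _] := key (delta_mx 0 i); rewrite subr_eq0 !delta => /eqP.
Qed.

(** * The Gaussian and its derivatives *)

Section Gaussian.
Variables (R : realType) (N : nat).
Implicit Types (x v : 'rV[R]_N) (a c : R).

Lemma is_derive_comp_real (h : R -> R) (g : 'rV[R]_N -> R) x v (p q : R) :
  is_derive (g x) 1 h p -> is_derive x v g q -> is_derive x v (h \o g) (p * q).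
Proof.
move=> hp gq; apply: is_derive_line0.
apply: (@is_derive1_comp _ h (fun s => g (x + s *: v))).
  by rewrite scale0r addr0.
by apply: is_derive_line; rewrite scale0r addr0.
Qed.

Lemma is_derive_coord x v (i : 'I_N) :
  is_derive x v (fun y : 'rV[R]_N => y 0 i) (v 0 i).
Proof.
apply: is_derive_line0.
rewrite (_ : (fun s => _) = cst (x 0 i) + (v 0 i \*: id)); last first.
  by apply/funext => s; rewrite !mxE mulrC.
apply: is_derive_eq; rewrite add0r; exact: mulr1.
Qed.

Definition gaussian a c x : R := c * expR (- a * \sum_i x 0 i ^+ 2).

Lemma is_derive_gaussian a c x v :
  is_derive x v (gaussian a c)
    (- (2 * a) * (\sum_i x 0 i * v 0 i) * gaussian a c x).
Proof.
pose s := \sum_(i < N) (fun y : 'rV[R]_N => y 0 i) ^+ 2.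
have sE : s = fun y => \sum_i y 0 i ^+ 2 by rewrite /s fct_sumE.
rewrite (_ : gaussian a c = c \*: (expR \o (- a \*: s))); last first.
  by apply/funext => y; rewrite /gaussian sE.
have ds : is_derive x v s (\sum_i (2 * x 0 i) * v 0 i).
  apply: is_derive_sum => i.
  have := @is_deriveX _ _ _ 2 _ _ _ (is_derive_coord x v i).
  by rewrite expr1.
have := is_deriveZ c
  (is_derive_comp_real (is_derive_expR _) (is_deriveZ (- a) ds)).
move=> /is_derive_eq; apply.
rewrite sE /GRing.scale /=.
have -> : \sum_i 2 * x 0 i * v 0 i = 2 * \sum_i x 0 i * v 0 i.
  by rewrite mulr_sumr; apply: eq_bigr => i _; rewrite mulrA.
set S := \sum_i x 0 i * v 0 i; set E := expR _.
rewrite -[RHS]/(- (2 * a) * S * (c * E)); ring.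
Qed.

Lemma continuous_gaussian a c : continuous (gaussian a c).
Proof.
move=> x; apply: differentiable_continuous.
have ds : differentiable (\sum_(i < N) (fun y : 'rV[R]_N => y 0 i) ^+ 2) x.
  apply: differentiable_sum => i; apply: differentiableX.
  exact: differentiable_coord.
rewrite (_ : gaussian a c = c \*: (expR \o (- a \*:
  \sum_(i < N) (fun y : 'rV[R]_N => y 0 i) ^+ 2))); last first.
  by apply/funext => y; rewrite /gaussian fct_sumE.
apply: differentiableZ; apply: differentiable_comp.
  exact: differentiableZ.
exact/derivable1_diffP/ex_derive.
Qed.

Lemma partial_gaussian a c i :
  partial i (gaussian a c) = fun x => - (2 * a) * x 0 i * gaussian a c x.
Proof.
apply/funext => x; rewrite /partial.
rewrite (derive_val (is_derive := is_derive_gaussian _ _ _ _)).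
rewrite (bigD1 i)//= big1 ?addr0 => [|j ji]; rewrite mxE ?eqxx ?mulr1//.
by rewrite (negPf ji) andbF mulr0.
Qed.

Lemma grad_gaussian a c x :
  grad (gaussian a c) x = (- (2 * a) * gaussian a c x) *: x.
Proof. by apply/rowP => i; rewrite !mxE partial_gaussian mulrAC. Qed.

Lemma is_derive_partial_gaussian a c i j x :
  is_derive x (delta_mx 0 i) (partial j (gaussian a c))
    (gaussian a c x * ((4 * a ^+ 2) * (x 0 i * x 0 j) - (2 * a) * (i == j)%:R)).
Proof.
rewrite partial_gaussian.
have := is_deriveM (is_deriveZ (- (2 * a)) (is_derive_coord x (delta_mx 0 i) j))
  (is_derive_gaussian a c x (delta_mx 0 i)).
move=> /is_derive_eq; apply.
rewrite (bigD1 i)//= big1 ?addr0 => [|k ki]; last first.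
  by rewrite mxE (negPf ki) andbF mulr0.
by rewrite !mxE !eqxx /= [j == i]eq_sym /GRing.scale/=; ring.
Qed.

Lemma partial2_gaussian a c i j :
  partial i (partial j (gaussian a c)) = fun x =>
    gaussian a c x * ((4 * a ^+ 2) * (x 0 i * x 0 j) - (2 * a) * (i == j)%:R).
Proof.
apply/funext => x; rewrite {1}/partial.
by rewrite (derive_val (is_derive := is_derive_partial_gaussian _ _ _ _ _)).
Qed.

Lemma C2_gaussian a c (U : set 'rV[R]_N) : C2_on U (gaussian a c).
Proof.
have coordC (i : 'I_N) (x : 'rV[R]_N) :
    {for x, continuous (fun y : 'rV[R]_N => y 0 i)}.
  exact: coord_continuous.
have cstC (r : R) (x : 'rV[R]_N) : {for x, continuous (fun=> r : R)}.
  exact: cst_continuous.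
move=> x _; split=> [|i|i j]; first exact: continuous_gaussian.
- split; first exact: (ex_derive (is_derive := is_derive_gaussian _ _ _ _)).
  rewrite partial_gaussian.
  apply: continuousM; last exact: continuous_gaussian.
  by apply: continuousM; [exact: cstC|exact: coordC].
- split.
    exact: (ex_derive (is_derive := is_derive_partial_gaussian _ _ _ _ _)).
  rewrite partial2_gaussian.
  apply: continuousM; first exact: continuous_gaussian.
  apply: continuousB; last exact: cstC.
  apply: continuousM; first exact: cstC.
  by apply: continuousM; exact: coordC.
Qed.

Lemma hess_gaussian a c x : hess (gaussian a c) x =
  gaussian a c x *: ((4 * a ^+ 2) *: (x^T *m x) - (2 * a)%:M).
Proof.
apply/matrixP => i j; rewrite !mxE partial2_gaussian big_ord1 !mxE.
by rewrite mulr_natr.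
Qed.

(** The rank one part of the Hessian vanishes on the hyperplane orthogonal to
    [x]; this is why the Gaussian is concave enough for [Pminus k], [k < N],
    at every distance from the origin. *)
Lemma hess_gaussian_orthogonal a c x v : (v *m x^T) 0 0 = 0 ->
  (v *m hess (gaussian a c) x *m v^T) 0 0 =
    - (2 * a * gaussian a c x) * (v *m v^T) 0 0.
Proof.
move=> vx; have {}vx : v *m x^T = 0.
  by apply/matrixP => i j; rewrite !ord1 vx mxE.
rewrite hess_gaussian -scalemxAr mulmxBr -scalemxAr mulmxA vx mul0mx scaler0.
rewrite sub0r mul_mx_scalar scalerN -scaleNr scalerA -scalemxAl mxE.
by rewrite mulNr [gaussian a c x * _]mulrC.
Qed.

End Gaussian.

(** * Supersolutions and the maximum principle *)

Section Viscosity.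
Variables (R : realType) (N : nat).
Implicit Types (Om D U K : set 'rV[R]_N) (u w phi : 'rV[R]_N -> R).
Implicit Types (H : 'rV[R]_N -> 'rV[R]_N -> R).

Lemma gaussian_gt0 a c (x : 'rV[R]_N) : 0 < c -> 0 < gaussian a c x.
Proof. by move=> c0; rewrite mulr_gt0// expR_gt0. Qed.

Lemma continuous_lsc_on D w : continuous w -> lsc_on D w.
Proof.
move=> wc x a; rewrite lte_fin => aw.
exists [set y | a < w y]; last by move=> y; rewrite lte_fin.
have xV : nbhs (x : 'rV[R]_N) (w @^-1` [set t | a < t]).
  by apply: (wc x); apply: open_nbhs_nbhs; split; [exact: open_gt|].
change (nbhs_subspace x [set y | a < w y]); rewrite /nbhs_subspace.
case: ifP => _; first exact: cvg_within xV.
by move=> y ->.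
Qed.

(** The computation behind both parts. [H] enters through its values on
    multiples of [x], the direction of the gradient of the Gaussian; in the
    presence of a bound [b * |xi|] one takes [m = b * r]. The multiple [c] is
    free because the maximum principle compares [u] with an arbitrary
    positive multiple of the Gaussian, which is then its own test function. *)
Lemma gaussian_strict_supersolution k H (m mu a c : R) (x : 'rV[R]_N) U phi :
  (k < N)%N -> 0 < a -> 0 < c -> mu < 2 * a * (k%:R - m) ->
  (forall s, H x (s *: x) <= `|s| * m) ->
  open U -> U x -> C2_on U phi -> phi x = gaussian a c x ->
  (forall y, U y -> phi y <= gaussian a c y) ->
  Eop k H mu x (phi x) (grad phi x) (hess phi x) < 0.
Proof.
move=> kN a0 c0 mua Hm oU Ux phiU phix le_phi.
have [gradE hess_le] :=
  touching_derivatives oU Ux phiU (@C2_gaussian _ _ a c U) phix le_phi.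
have g0 := gaussian_gt0 a x c0.
have P_le : Pminus k (hess phi x) <= k%:R * - (2 * a * gaussian a c x).
  apply: (Pminus_le_hyperplane (x := x) kN); first exact: (@hess_sym _ _ U).
  by move=> v vx; rewrite -hess_gaussian_orthogonal.
have H_le : H x (grad phi x) <= 2 * a * gaussian a c x * m.
  rewrite gradE grad_gaussian; apply: le_trans (Hm _) _.
  by rewrite mulNr normrN ger0_norm // ltW // mulr_gt0 // mulr_gt0.
rewrite /Eop phix; apply: le_lt_trans (lerD (lerD P_le H_le) (lexx _)) _.
rewrite (_ : _ + _ = gaussian a c x * (mu - 2 * a * (k%:R - m))); last by ring.
by rewrite pmulr_rlt0// subr_lt0.
Qed.

Lemma decay_rate (mu d : R) : 0 < d -> exists2 a, 0 < a & mu < 2 * a * d.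
Proof.
move=> d0; exists ((`|mu| + 1) / (2 * d)).
  by rewrite divr_gt0 ?mulr_gt0// ltr_wpDl.
rewrite (_ : 2 * _ * d = `|mu| + 1); last by field; rewrite lt0r_neq0.
by rewrite ltr_pwDr// ler_norm.
Qed.

Lemma exists_positive_supersolution k H Om (m mu : R) :
  (k < N)%N -> m < k%:R ->
  (forall x s, Om x -> H x (s *: x) <= `|s| * m) ->
  exists w, [/\ forall x, 0 < w x, forall D, lsc_on D w &
    supersolution (Eop k H mu) Om w].
Proof.
move=> kN mk Hm; have [a a0 mua] : exists2 a, 0 < a & mu < 2 * a * (k%:R - m).
  by apply: decay_rate; rewrite subr_gt0.
exists (gaussian a 1); split=> [x|D|].
- by rewrite gaussian_gt0.
- exact/continuous_lsc_on/continuous_gaussian.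
split=> [|x phi Omx [U [oU Ux UOm phiU [phix le_phi]]]].
  exact/continuous_lsc_on/continuous_gaussian.
rewrite -phix ltW//; apply: (gaussian_strict_supersolution (m := m) (U := U)
  kN a0 ltr01 mua) => //.
by move=> s; exact: Hm.
Qed.

Lemma mu_infinite k H Om (m : R) :
  (k < N)%N -> m < k%:R ->
  (forall x s, Om x -> H x (s *: x) <= `|s| * m) ->
  mu_plus k H Om = +oo%E /\ mu_bar k H Om = +oo%E.
Proof.
move=> kN mk Hm; split; apply: eq_infty => mu; apply: ereal_sup_ubound;
  exists mu => //=;
  by have [w [w0 wl ws]] := exists_positive_supersolution mu kN mk Hm; exists w.
Qed.

(** The nonempty superlevel sets [h z <= h] in [K] generate a proper filter,
    and by upper semicontinuity [h] is maximal at any of its cluster points. *)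
Lemma usc_attains_max K (h : 'rV[R]_N -> R) :
  compact K -> K !=set0 ->
  (forall x a, K x -> h x < a -> \forall y \near x, K y -> h y < a) ->
  exists2 x, K x & forall y, K y -> h y <= h x.
Proof.
move=> Kc K0 hu.
pose F := filter_from K (fun z => [set y | K y /\ h z <= h y]).
have FF : ProperFilter F.
  apply: filter_from_proper; last by move=> z Kz; exists z.
  apply: filter_from_filter; first by [].
  move=> y z Ky Kz; have [yz|zy] := leP (h y) (h z).
    by exists z => // t [Kt zt]; split; split=> //; exact: le_trans zt.
  exists y => // t [Kt yt]; split; split=> //.
  by apply: le_trans yt; exact: ltW.
have FK : F K by case: K0 => z Kz; exists z => // y [].
have [x [Kx xF]] := Kc F FF FK.
exists x => // z Kz; rewrite leNgt; apply/negP => xz.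
have Fz : F [set y | K y /\ h z <= h y] by exists z.
have [y [[Ky zy] /(_ Ky)]] := xF _ _ Fz (hu x _ Kx xz).
by rewrite ltNge zy.
Qed.

Lemma usc_onP Om u (x : 'rV[R]_N) a : usc_on Om u -> Om x -> u x < a ->
  \forall y \near x, Om y -> u y < a.
Proof.
move=> uu Omx ua; have [|V] := uu x (- a); first by rewrite lte_fin ltrN2.
move=> xV; have {xV} : nbhs_subspace (x : subspace Om) V := xV.
rewrite -nbhs_subspace_in// => xV Va.
apply: (@filterS _ _ _ [set y | Om y -> V y]) xV => y Vy Omy.
by move: (Va y (Vy Omy)); rewrite lte_fin ltrN2.
Qed.

Lemma limsup_lt_near_boundary Om u e :
  (limf_esup (fun x => (u x)%:E) (within Om (set_nbhs (boundary Om))) <= 0)%E ->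
  0 < e ->
  exists V, [/\ open V, boundary Om `<=` V & forall y, V y -> Om y -> u y < e].
Proof.
move=> lim_le e0; have : (limf_esup (fun x => (u x)%:E)
    (within Om (set_nbhs (boundary Om))) < e%:E)%E.
  by apply: le_lt_trans lim_le _; rewrite lte_fin.
move=> /ereal_inf_lt[_ [A FA <-]] Ae.
have /set_nbhsP[V [oV bV VA]] :
  set_nbhs (boundary Om) [set y | Om y -> A y] := FA.
exists V; split=> // y /VA Ay /Ay Ay'.
rewrite -lte_fin; apply: le_lt_trans Ae; apply: ereal_sup_ubound.
by exists y.
Qed.

Lemma compact_closure Om : bounded_set Om -> compact (closure Om).
Proof.
move=> [M [Mreal OmM]].
apply: bounded_closed_compact; last exact: closed_closure.
have cB : closed [set x : 'rV[R]_N | `|x| <= M + 1].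
  apply: (@closed_comp _ _ _ [set t : R | t <= M + 1]); last exact: closed_le.
  by move=> x _; exact: norm_continuous.
have OmB : closure Om `<=` [set x : 'rV[R]_N | `|x| <= M + 1].
  rewrite closureE; apply: smallest_sub => // x Omx /=.
  by apply: OmM => //; rewrite ltrDl.
exists (M + 1); split; first exact: num_real.
by move=> t Mt x /OmB /= xM; apply: le_trans xM (ltW Mt).
Qed.

(** Outside the compact part [K] of [Om] the ratio [u / w] stays below its
    value at the point [x1] where [u] is assumed positive, so its maximum over
    [K] is a maximum over [Om]. *)
Lemma maximum_principle_Eop k H Om (m mu : R) :
  (k < N)%N -> m < k%:R ->
  (forall x s, Om x -> H x (s *: x) <= `|s| * m) ->
  open Om -> bounded_set Om ->
  maximum_principle (Eop k H mu) Om.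
Proof.
move=> kN mk Hm oOm bOm u [uu usub] ulim x1 Omx1.
rewrite leNgt; apply/negP => u1.
have [a a0 mua] : exists2 a, 0 < a & mu < 2 * a * (k%:R - m).
  by apply: decay_rate; rewrite subr_gt0.
pose w := gaussian a 1 : 'rV[R]_N -> R.
have w0 x : 0 < w x by rewrite gaussian_gt0.
have wc : continuous w by exact: continuous_gaussian.
have cOm := compact_closure bOm.
have [x2 _ wmin] := EVT_min_rV (ex_intro _ x1 (subset_closure Omx1)) cOm
  (continuous_subspaceT wc).
pose c1 := u x1 / w x1.
have c10 : 0 < c1 by rewrite divr_gt0.
have [V [oV bV Vu]] := limsup_lt_near_boundary ulim (mulr_gt0 c10 (w0 x2)).
have uV y : V y -> Om y -> u y / w y < c1.
  move=> Vy Omy; rewrite ltr_pdivrMr//; apply: lt_le_trans (Vu y Vy Omy) _.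
  by rewrite ler_pM2l// wmin// inE; exact: subset_closure.
pose K := closure Om `&` ~` V.
have KOm : K `<=` Om.
  move=> y [cy Vy]; apply: contrapT => nOmy; apply: Vy; apply: bV; split=> //.
  by move=> /interior_subset.
have Kx1 : K x1.
  by split; [exact: subset_closure|move=> /uV/(_ Omx1); rewrite ltxx].
have [|||x0 Kx0 x0max] := @usc_attains_max K (fun y => u y / w y).
- by apply: compact_closedI => //; exact: open_closedC.
- by exists x1.
- move=> x b /KOm Omx; rewrite ltr_pdivrMr// => ub.
  have [um mb] := midf_lt ub; set q := (u x + b * w x) / 2 in um mb.
  have bw : \forall y \near x, q < b * w y.
    have bwc : (fun y => b * w y) @ x --> b * w x.
      by apply: continuousM; [exact: cst_continuous|exact: wc].
    exact: (cvgr_gt _ bwc _ mb).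
  apply: filterS2 (usc_onP uu Omx um) bw => y uq qb /KOm/uq uyq.
  by rewrite ltr_pdivrMr// (lt_trans uyq).
have Omx0 := KOm x0 Kx0.
pose t := u x0 / w x0.
have c1t : c1 <= t by exact: x0max.
have t0 : 0 < t by exact: lt_le_trans c1t.
have gE y : gaussian a t y = t * w y by rewrite /w /gaussian mul1r.
have ux0 : gaussian a t x0 = u x0 by rewrite gE /t divfK// lt0r_neq0.
have u_le y : Om y -> u y <= gaussian a t y.
  move=> Omy; rewrite gE -ler_pdivrMr//.
  have [/uV/(_ Omy) uy|nVy] := pselect (V y).
    by apply: le_trans c1t; exact: ltW.
  by apply: x0max; split => //; exact: subset_closure.
have gC2 : C2_on Om (gaussian a t) by exact: C2_gaussian.
have touch : touches_above Om u x0 (gaussian a t) by exists Om; split.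
have := usub x0 _ Omx0 touch; rewrite leNgt => /negP; apply.
rewrite -ux0.
apply: (gaussian_strict_supersolution (U := Om) kN a0 t0 mua) => // s.
exact: Hm.
Qed.

Lemma enormZ (s : R) (x : 'rV[R]_N) : enorm (s *: x) = `|s| * enorm x.
Proof.
rewrite /enorm -sqrtr_sqr -sqrtrM ?sqr_ge0//; congr Num.sqrt.
by rewrite mulr_sumr; apply: eq_bigr => i _; rewrite mxE exprMn.
Qed.
End Viscosity.

Theorem proposition4p3 (R : realType) (N : nat) (hN : (2 <= N)%N) :
  (forall (Om : set 'rV[R]_N) (H : 'rV[R]_N -> 'rV[R]_N -> R) (b r : R),
     bounded_domain Om ->
     {within Om `*` [set: 'rV[R]_N], continuous (fun z => H z.1 z.2)} ->
     0 <= b ->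
     (forall x xi, Om x -> `|H x xi| <= b * enorm xi) ->
     0 < r ->
     Om `<=` eball r ->
     forall k : nat, (1 <= k < N)%N ->
       b * r < k%:R -> mu_plus k H Om = +oo%E /\ mu_bar k H Om = +oo%E)
  /\
  (forall (Om : set 'rV[R]_N), bounded_domain Om ->
     forall k : nat, (1 <= k < N)%N ->
       [/\ mu_plus k (fun _ _ => 0) Om = +oo%E,
           mu_bar k (fun _ _ => 0) Om = +oo%E &
           forall mu : R,
             maximum_principle (Eop k (fun _ _ => 0) mu) Om]).
Proof.
split=> [Om H b r _ _ b0 Hb _ Omr k /andP[_ kN] brk|
         Om [oOm _ _ bOm] k /andP[k0 kN]].
  apply: (mu_infinite kN brk) => x s Omx.
  apply: le_trans (ler_norm _) (le_trans (Hb _ _ Omx) _).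
  rewrite enormZ mulrCA ler_wpM2l// ler_wpM2l// ltW//; exact: Omr.
have k0R : 0 < k%:R :> R by rewrite ltr0n.
have Hm (x : 'rV[R]_N) (s : R) : Om x -> 0 <= `|s| * 0 by rewrite mulr0.
have [mp mb] := @mu_infinite R N k (fun _ _ => 0) Om 0 kN k0R Hm.
by split=> // mu; exact: (@maximum_principle_Eop R N k (fun _ _ => 0) Om 0).
Qed.
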